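(* Let $A$ be a Hermitian $n\times n$ matrix with pairwise distinct eigenvalues $\lambda_1,\dots,\lambda_n$ and corresponding normalized eigenvectors $\mathbf{v}_1,\dots,\mathbf{v}_n\in\mathbb{C}^n$, and let $\mathcal{G}(A)=\{\mathbf{x}\in\mathbb{C}^n \mid \langle\mathbf{x},\mathbf{v}_k\rangle_{\mathbb{C}^n}\ne0,\ k=1,2,\dots,n\}$. Let $k$ be a natural number, let $z_1,\dots,z_k$ be pairwise distinct complex numbers, and let $m_1,\dots,m_k$ be natural numbers (positive integers) with $m_1+m_2+\dots+m_k=n$. (1) For every vector $\boldsymbol{\varphi}\in\mathcal{G}(A)$ there is a unique vector $\boldsymbol{\psi}\in\mathbb{C}^n$ such that the matrix $B=A+\boldsymbol{\psi}\boldsymbol{\varphi}^{*}$ has eigenvalues $z_1,\dots,z_k$ of corresponding algebraic multiplicities $m_1,\dots,m_k$. (2) Similarly, for every vector $\boldsymbol{\psi}\in\mathcal{G}(A)$ there is a unique vector $\boldsymbol{\varphi}\in\mathbb{C}^n$ such that the matrix $B=A+\boldsymbol{\psi}\boldsymbol{\varphi}^{*}$ has eigenvalues $z_1,\dots,z_k$ of corresponding algebraic multiplicities $m_1,\dots,m_k$.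
   Context: Vectors of $\mathbb{C}^n$ are column vectors; $\langle\cdot,\cdot\rangle_{\mathbb{C}^n}$ is the standard inner product, linear in the first argument; $\boldsymbol{\varphi}^{*}$ is the conjugate transpose of $\boldsymbol{\varphi}$, so that $B\mathbf{x}=A\mathbf{x}+\langle\mathbf{x},\boldsymbol{\varphi}\rangle_{\mathbb{C}^n}\boldsymbol{\psi}$. *)

(* Defs.v *)
From HB Require Import structures.
From mathcomp Require Import all_boot all_order all_algebra.
From mathcomp Require Export complex.
From mathcomp Require Export reals.

Set Implicit Arguments.
Unset Strict Implicit.
Unset Printing Implicit Defensive.

Import Order.TTheory GRing.Theory Num.Theory.
Local Open Scope ring_scope.
Local Open Scope sesquilinear_scope.

(* mathcomp's [dotmx] is for row vectors; here vectors are columns. *)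
Definition inner (C : numClosedFieldType) (n : nat) (x y : 'cV[C]_n) : C :=
  \sum_(i < n) x i 0 * (y i 0)^*.

Definition normalized_eigenvector (C : numClosedFieldType) (n : nat)
    (A : 'M[C]_n) (lambda : C) (v : 'cV[C]_n) : Prop :=
  [/\ v != 0, A *m v = lambda *: v & inner v v = 1].

(* The set G(A); it is given through the eigenvectors v_1, ..., v_n of A. *)
Definition generic_vector (C : numClosedFieldType) (n : nat)
    (v : 'I_n -> 'cV[C]_n) (x : 'cV[C]_n) : Prop :=
  forall k : 'I_n, inner x (v k) <> 0.

Definition rank_one_perturbation (C : numClosedFieldType) (n : nat)
    (A : 'M[C]_n) (psi phi : 'cV[C]_n) : 'M[C]_n :=
  A + psi *m phi ^t*.

Definition algebraic_multiplicity (C : numClosedFieldType) (n : nat)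
    (B : 'M[C]_n) (z : C) : nat :=
  mup z (char_poly B).

(* [eigenvalue] is defined by row vectors (v *m B = z *: v); this gives the
   same eigenvalues as column vectors, by [eigenvalue_root_char]. *)
Definition has_eigenvalues (C : numClosedFieldType) (n k : nat)
    (B : 'M[C]_n) (z : 'I_k -> C) (m : 'I_k -> nat) : Prop :=
  forall j : 'I_k,
    eigenvalue B (z j) /\ algebraic_multiplicity B (z j) = m j.

(* Main.v *)
Require Import Defs.
From mathcomp Require Import all_boot all_order all_algebra.

Set Implicit Arguments.
Unset Strict Implicit.
Unset Printing Implicit Defensive.

Import GRing.Theory Num.Theory.
Local Open Scope ring_scope.

(** The prescribed eigenvalues and multiplicities, being exhaustive
    ([\sum_j m j = n]), say that the characteristic polynomial of the perturbed
    matrix [B] is [p = \prod_j ('X - z j) ^+ m j] ([has_eigenvaluesP]).  Both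
    polynomials are monic of degree [n], so it suffices to compare their values
    at the [n] distinct points [lambda i] ([monic_eq_on]).

    At these points the characteristic polynomial of [B] is explicit.  The
    eigenvectors of [A] are orthonormal, so in the basis [v] the matrix
    [lambda i - B] becomes a diagonal matrix with a zero in position [i], minus
    the product of the column of the [<psi, v_r>] and the row of the conjugates
    of the [<phi, v_s>].  Its determinant is a single product
    ([det_diag_sub_rank_one]), and
      [char_poly B (lambda i)
         = - <psi, v_i> <phi, v_i>^* \prod_(j != i) (lambda i - lambda j)].
    The last product is nonzero because the spectrum is simple.  The problem is
    therefore equivalent to [n] uncoupled equations
      [<psi, v_i> <phi, v_i>^* = w i]
    with constants [w i] that depend on neither vector
    ([has_eigenvalues_perturbationP]).  If one of the two vectors has no
    vanishing coordinate in the basis [v], these equations determine every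
    coordinate of the other one, hence that vector. *)

(** * A determinant *)

Lemma det_pivot_row (K : comNzRingType) (n : nat) (M : 'M[K]_n) (i : 'I_n) :
  (forall j, j != i -> M i j = 0) ->
  \det M = M i i * \det (row' i (col' i M)).
Proof.
move=> M0; rewrite (expand_det_row M i) (bigD1 i) //= big1 ?addr0.
  by rewrite /cofactor -signr_odd addnn odd_double mul1r.
by move=> j ji; rewrite M0 ?mul0r.
Qed.

(** As [d i = 0], row [i] of the matrix is [- a i] times the row [b], and row
    operations with row [b] as pivot clear the rank-one part from all the other
    rows.  In matrix form this is a factorization [L *m N], where [L] and [N]
    differ from the identity and from the diagonal matrix only in column [i]
    and in row [i] respectively.  The product ranges over the [d j], [j != i]. *)
Lemma det_diag_sub_rank_one (K : comNzRingType) (n : nat)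
    (d a b : 'I_n -> K) (i : 'I_n) : d i = 0 ->
  \det (\matrix_(r, s) (d r *+ (r == s) - a r * b s)) =
  - (a i * b i) * \prod_(j < n.-1) d (lift i j).
Proof.
move=> di0.
pose L := \matrix_(r, s) (if s == i then - a r else (r == s)%:R).
pose N := \matrix_(r, s) (if r == i then b s else d r *+ (r == s)).
have -> : (\matrix_(r, s) (d r *+ (r == s) - a r * b s)) = L *m N.
  apply/matrixP=> r s; rewrite !mxE (bigD1 i) //= !mxE !eqxx.
  rewrite addrC mulNr; congr (_ + _).
  have [->|ri] := eqVneq r i.
    rewrite di0 mul0rn big1 // => t ti.
    by rewrite !mxE (negPf ti) eq_sym (negPf ti) mul0r.
  rewrite (bigD1 r) //= !mxE (negPf ri) eqxx mul1r big1 ?addr0 //.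
  move=> t /andP[ti tr].
  by rewrite !mxE (negPf ti) eq_sym (negPf tr) mul0r.
have detL : \det L = - a i.
  rewrite (@det_pivot_row _ _ _ i) => [|j ji]; last first.
    by rewrite mxE (negPf ji) eq_sym (negPf ji).
  rewrite mxE eqxx (_ : row' i (col' i L) = 1%:M) ?det1 ?mulr1 //.
  apply/matrixP=> r s; rewrite !mxE.
  by rewrite eq_sym (negPf (neq_lift i s)) (inj_eq (@lift_inj _ i)).
have detN : \det N = b i * \prod_(j < n.-1) d (lift i j).
  rewrite -det_tr (@det_pivot_row _ _ _ i) => [|j ji]; last first.
    by rewrite !mxE (negPf ji).
  rewrite !mxE eqxx; congr (_ * _).
  rewrite (_ : row' i _ = diag_mx (\row_j d (lift i j))).
    by rewrite det_diag; apply: eq_bigr => j _; rewrite mxE.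
  apply/matrixP=> r s; rewrite !mxE.
  rewrite eq_sym (negPf (neq_lift i s)) (inj_eq (@lift_inj _ i)) eq_sym.
  by have [->|] := eqVneq r s.
by rewrite det_mulmx detL detN mulrA mulNr.
Qed.

(** * Polynomials with prescribed values or prescribed roots *)

(** The leading terms cancel in [p - q], which thus has degree less than [n]
    and vanishes at [n] distinct points. *)
Lemma monic_eq_on (F : fieldType) (n : nat) (p q : {poly F}) (x : 'I_n -> F) :
  injective x -> p \is monic -> q \is monic ->
  size p = n.+1 -> size q = n.+1 ->
  (forall i, p.[x i] = q.[x i]) -> p = q.
Proof.
move=> xI pm qm sp sq pq; apply/eqP; rewrite -subr_eq0; apply/negPn/negP => nz.
have /= := @max_poly_roots _ _ [seq x i | i <- enum 'I_n] nz.
have -> : all (root (p - q)) [seq x i | i <- enum 'I_n].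
  by apply/allP=> _ /mapP[i _ ->]; rewrite /root hornerD hornerN pq subrr.
rewrite map_inj_uniq // enum_uniq size_map size_enum_ord => /(_ isT isT).
rewrite ltnNge => /negP; apply.
apply/leq_sizeP => j; rewrite leq_eqVlt coefB => /orP[/eqP <-|nj].
  move: (monicP pm) (monicP qm); rewrite /lead_coef sp sq /= => -> ->.
  by rewrite subrr.
by rewrite !nth_default ?subrr ?sp ?sq.
Qed.

Lemma mup_prod_XsubCX (F : fieldType) (k : nat) (z : 'I_k -> F)
    (m : 'I_k -> nat) (j : 'I_k) : injective z ->
  mup (z j) (\prod_(l < k) ('X - (z l)%:P) ^+ m l) = m j.
Proof.
move=> zI; rewrite (bigD1 j) //= mupMl.
  by rewrite mup_XsubCX eqxx.
rewrite /root horner_prod; apply/prodf_neq0 => l lj.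
by rewrite horner_exp hornerXsubC expf_neq0 // subr_eq0 (inj_eq zI) eq_sym.
Qed.

(** Powers of distinct linear factors are pairwise coprime. *)
Lemma prod_XsubCX_dvdp (F : fieldType) (k : nat) (z : 'I_k -> F)
    (m : 'I_k -> nat) (p : {poly F}) : injective z ->
  (forall j, ('X - (z j)%:P) ^+ m j %| p) ->
  \prod_(j < k) ('X - (z j)%:P) ^+ m j %| p.
Proof.
elim: k z m => [|k IH] z m zI zp; first by rewrite big_ord0 dvd1p.
rewrite big_ord_recl Gauss_dvdp.
  rewrite zp /=; apply: (IH (z \o lift ord0) (m \o lift ord0)) => [|j].
    exact: inj_comp zI (@lift_inj _ _).
  exact: zp.
rewrite coprimep_sym; apply: (big_ind (fun q => coprimep q _)) => [|p1 p2 h1 h2|j _].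
- exact: coprime1p.
- by rewrite coprimepMl h1.
- rewrite coprimep_expl // coprimep_expr // coprimep_XsubC root_XsubC.
  by rewrite (inj_eq zI) neq_lift.
Qed.

Lemma size_prod_XsubCX (F : fieldType) (k : nat) (z : 'I_k -> F)
    (m : 'I_k -> nat) :
  size (\prod_(j < k) ('X - (z j)%:P) ^+ m j) = (\sum_(j < k) m j).+1.
Proof.
elim: k z m => [|k IH] z m; first by rewrite !big_ord0 size_poly1.
rewrite !big_ord_recl size_monicM ?monic_exp ?monicXsubC //.
  by rewrite IH size_exp_XsubC addnS.
by rewrite monic_neq0 ?monic_prod // => j _; rewrite monic_exp ?monicXsubC.
Qed.

(** The condition that the multiplicities add up to [n] leaves no room for a
    further factor of the characteristic polynomial: the product on the right
    divides it and has the same degree. *)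
Lemma has_eigenvaluesP (C : numClosedFieldType) (n k : nat) (B : 'M[C]_n)
    (z : 'I_k -> C) (m : 'I_k -> nat) :
  injective z -> (forall j, (0 < m j)%N) -> (\sum_(j < k) m j)%N = n ->
  has_eigenvalues B z m <->
  char_poly B = \prod_(j < k) ('X - (z j)%:P) ^+ m j.
Proof.
move=> zI m_gt0 sum_m; split=> [Bz|charB j].
  have pm : \prod_(j < k) ('X - (z j)%:P) ^+ m j \is monic.
    by rewrite monic_prod // => j _; rewrite monic_exp ?monicXsubC.
  apply/esym/eqP; rewrite -eqp_monic ?char_poly_monic //.
  (* for a divisor, equal degrees suffice to be associate *)
  rewrite -dvdp_size_eqp; first by rewrite size_prod_XsubCX size_char_poly sum_m.
  apply: prod_XsubCX_dvdp => // j.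
  rewrite -mup_geq ?monic_neq0 ?char_poly_monic //.
  by have [_ <-] := Bz j.
have mupj : algebraic_multiplicity B (z j) = m j.
  by rewrite /algebraic_multiplicity charB mup_prod_XsubCX.
split=> //; rewrite eigenvalue_root_char -dvdp_XsubCl XsubC_dvd.
  by have := m_gt0 j; rewrite -mupj.
by rewrite monic_neq0 ?char_poly_monic.
Qed.

(** * Rank-one perturbations in the eigenbasis *)

Local Open Scope sesquilinear_scope.

Lemma innerE (C : numClosedFieldType) (n : nat) (x y : 'cV[C]_n) :
  inner x y = (y ^t* *m x) 0 0.
Proof. by rewrite mxE; apply: eq_bigr => i _; rewrite !mxE mulrC. Qed.

Section HermitianSimpleSpectrum.
Variables (C : numClosedFieldType) (n : nat) (A : 'M[C]_n).
Variables (lambda : 'I_n -> C) (v : 'I_n -> 'cV[C]_n).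
Hypothesis hA : A \is hermsymmx.
Hypothesis hlambda : injective lambda.
Hypothesis hv : forall i : 'I_n, normalized_eigenvector A (lambda i) (v i).

Let V : 'M[C]_n := \matrix_(r, s) v s r 0.

(** Moving [A] across [inner (v i) (v j)] shows that the eigenvalues are real
    (case [i = j]) and then that eigenvectors for distinct eigenvalues are
    orthogonal. *)
Lemma inner_eigenvectors (i j : 'I_n) : inner (v i) (v j) = (i == j)%:R.
Proof.
have AE : A ^t* = A.
  by apply/esym/eqP; move: hA; rewrite qualifE /= expr0 scale1r.
have lamE r s : lambda r * inner (v r) (v s) = (lambda s)^* * inner (v r) (v s).
  have [_ Ar _] := hv r; have [_ As _] := hv s.
  have -> : lambda r * inner (v r) (v s) = ((v s) ^t* *m (A *m v r)) 0 0.
    by rewrite Ar -scalemxAr mxE -innerE.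
  rewrite mulmxA -{1}AE -map_mxM -trmx_mul As.
  by rewrite linearZ /= map_mxZ -scalemxAl mxE -innerE.
have [_ _ vi1] := hv i.
have [<-//|ij] := eqVneq i j.
have lam_real : (lambda j)^* = lambda j.
  have [_ _ vj1] := hv j.
  by have := lamE j j; rewrite vj1 !mulr1.
apply/eqP; have /eqP := lamE i j.
rewrite lam_real -subr_eq0 -mulrBl mulf_eq0 subr_eq0 (inj_eq hlambda).
by rewrite (negPf ij).
Qed.

Lemma eigenbasis_adj_mul : V ^t* *m V = 1%:M.
Proof.
apply/matrixP=> i j; rewrite !mxE eq_sym -inner_eigenvectors.
by apply: eq_bigr => r _; rewrite !mxE mulrC.
Qed.

Lemma eigenbasis_mul_adj : V *m V ^t* = 1%:M.
Proof. exact: mulmx1C eigenbasis_adj_mul. Qed.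

Lemma eigenbasis_adj_mulE (x : 'cV[C]_n) (i : 'I_n) :
  (V ^t* *m x) i 0 = inner x (v i).
Proof. by rewrite mxE; apply: eq_bigr => r _; rewrite !mxE mulrC. Qed.

(** The coordinates [inner x (v i)] are the entries of [V ^t* *m x], and [V] is
    unitary. *)
Lemma exists_unique_coordinates (y : 'I_n -> C) :
  exists! x : 'cV[C]_n, forall i, inner x (v i) = y i.
Proof.
exists (V *m \col_i y i); split=> [i|x xy].
  by rewrite -eigenbasis_adj_mulE mulmxA eigenbasis_adj_mul mul1mx mxE.
rewrite -[x]mul1mx -eigenbasis_mul_adj -mulmxA; congr (_ *m _).
by apply/colP=> i; rewrite eigenbasis_adj_mulE mxE xy.
Qed.

(** Conjugation by the unitary matrix [V] turns [lambda i - B] into the matrix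
    of [det_diag_sub_rank_one], whose diagonal part
    [lambda i - lambda r] vanishes at [r = i]. *)
Lemma char_poly_perturbation_eigenvalue (psi phi : 'cV[C]_n) (i : 'I_n) :
  (char_poly (rank_one_perturbation A psi phi)).[lambda i] =
  - (inner psi (v i) * (inner phi (v i))^* ) *
    \prod_(j < n.-1) (lambda i - lambda (lift i j)).
Proof.
set B := rank_one_perturbation A psi phi.
have -> : (char_poly B).[lambda i] = \det ((lambda i)%:M - B).
  rewrite /char_poly -horner_evalE -det_map_mx; congr (\det _).
  apply/matrixP=> r s; rewrite !mxE /= /horner_eval.
  by rewrite hornerD hornerN hornerC hornerMn hornerX.
rewrite -(@det_diag_sub_rank_one _ _ (fun r => lambda i - lambda r)
  (fun r => inner psi (v r)) (fun r => (inner phi (v r))^* )) ?subrr //.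
have AV : A *m V = V *m diag_mx (\row_j lambda j).
  apply/matrixP=> r s; rewrite mul_mx_diag !mxE mulrC.
  have [_ /colP/(_ r) + _] := hv s; rewrite !mxE => <-.
  by apply: eq_bigr => t _; rewrite mxE.
have <- : V ^t* *m ((lambda i)%:M - B) *m V =
  \matrix_(r, s) ((lambda i - lambda r) *+ (r == s) -
     inner psi (v r) * (inner phi (v s))^* ).
  rewrite mulmxBr mulmxBl mul_mx_scalar -scalemxAl eigenbasis_adj_mul.
  rewrite /B /rank_one_perturbation mulmxDr mulmxDl -(mulmxA _ A) AV.
  rewrite mulmxA eigenbasis_adj_mul mul1mx mulmxA -(mulmxA _ _ V).
  have -> : phi ^t* *m V = (V ^t* *m phi) ^t*.
    by rewrite trmx_mul map_mxM /= trmxCK.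
  apply/matrixP=> r s; rewrite !mxE big_ord1 eigenbasis_adj_mulE.
  rewrite [X in _ - (_ + _ * X)]mxE [X in _ - (_ + _ * X^* )]mxE eigenbasis_adj_mulE.
  by rewrite opprD addrA mulr_natr mulrnBl.
rewrite [RHS]det_mulmx det_mulmx.
by rewrite mulrAC -det_mulmx eigenbasis_adj_mul det1 mul1r.
Qed.

(** The inverse spectral problem reduces to uncoupled scalar equations.  Their
    right-hand sides are the same for all pairs [psi], [phi], so this one
    equivalence serves both when [phi] and when [psi] is given; they come from
    solving [char_poly_perturbation_eigenvalue] for the product of
    coordinates. *)
Lemma has_eigenvalues_perturbationP (k : nat) (z : 'I_k -> C)
    (m : 'I_k -> nat) :
  injective z -> (forall j, (0 < m j)%N) -> (\sum_(j < k) m j)%N = n ->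
  exists w : 'I_n -> C, forall psi phi : 'cV[C]_n,
    has_eigenvalues (rank_one_perturbation A psi phi) z m <->
    forall i, inner psi (v i) * (inner phi (v i))^* = w i.
Proof.
move=> zI m_gt0 sum_m.
pose p := \prod_(j < k) ('X - (z j)%:P) ^+ m j.
pose c i := \prod_(j < n.-1) (lambda i - lambda (lift i j)).
have c_neq0 i : c i != 0.
  by apply/prodf_neq0 => j _; rewrite subr_eq0 (inj_eq hlambda) neq_lift.
exists (fun i => - (p.[lambda i] / c i)) => psi phi.
have charE i : (char_poly (rank_one_perturbation A psi phi)).[lambda i] =
    - (inner psi (v i) * (inner phi (v i))^* ) * c i.
  exact: char_poly_perturbation_eigenvalue.
rewrite (has_eigenvaluesP _ zI m_gt0 sum_m) -/p; split=> [charB i|ab].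
  by rewrite -charB charE mulfK // opprK.
apply: (monic_eq_on hlambda) => [|||| i].
- exact: char_poly_monic.
- by rewrite monic_prod // => j _; rewrite monic_exp ?monicXsubC.
- exact: size_char_poly.
- by rewrite size_prod_XsubCX sum_m.
- by rewrite charE ab opprK divfK.
Qed.

End HermitianSimpleSpectrum.

Theorem theorem5p1 (R : realType) (n : nat) (A : 'M[R[i]]_n)
    (lambda : 'I_n -> R[i]) (v : 'I_n -> 'cV[R[i]]_n)
    (hA : A \is hermsymmx)
    (hlambda : injective lambda)
    (hv : forall i : 'I_n, normalized_eigenvector A (lambda i) (v i))
    (k : nat) (hk : (0 < k)%N)
    (z : 'I_k -> R[i]) (hz : injective z)
    (m : 'I_k -> nat) (hm : forall j : 'I_k, (0 < m j)%N)
    (hsum : (\sum_(j < k) m j)%N = n) :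
  (forall phi : 'cV[R[i]]_n, generic_vector v phi ->
     exists! psi : 'cV[R[i]]_n,
       has_eigenvalues (rank_one_perturbation A psi phi) z m)
  /\
  (forall psi : 'cV[R[i]]_n, generic_vector v psi ->
     exists! phi : 'cV[R[i]]_n,
       has_eigenvalues (rank_one_perturbation A psi phi) z m).
Proof.
have [w wP] := has_eigenvalues_perturbationP hA hlambda hv hz hm hsum.
split=> [phi phi_gen|psi psi_gen].
  have [psi [psiE psi_uniq]] := exists_unique_coordinates hA hlambda hv
    (fun i => w i / (inner phi (v i))^* ).
  have phi_neq0 i : (inner phi (v i))^* != 0.
    by rewrite conjC_eq0; apply/eqP/phi_gen.
  exists psi; split=> [|psi' /wP psi'E].
    by apply/wP => i; rewrite psiE divfK.
  by apply: psi_uniq => i; rewrite -psi'E mulfK.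
have psi_neq0 i : inner psi (v i) != 0 by apply/eqP/psi_gen.
have [phi [phiE phi_uniq]] := exists_unique_coordinates hA hlambda hv
  (fun i => (w i / inner psi (v i))^* ).
exists phi; split=> [|phi' /wP phi'E].
  by apply/wP => i; rewrite phiE conjCK mulrC divfK.
by apply: phi_uniq => i; rewrite -phi'E mulrC mulKf // conjCK.
Qed.
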